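(* If $u$ and $v$ are twins in $X$, then $u$ and $v$ are cospectral with respect to $M$.
   Context: $X$ is a finite connected undirected graph with nonzero real edge weights, loops allowed, no multiple edges. $A$ is its adjacency matrix: $(A)_{j,\ell}$ is the weight of the edge $(j,\ell)$ (for $j=\ell$, the weight of the loop at $j$), and $0$ if there is no such edge. $\deg(u)=2(A)_{u,u}+\sum_{j\neq u}(A)_{u,j}$ and $D$ is the diagonal matrix of degrees. Fix real $\alpha,\beta,\gamma$ with $\gamma\neq0$. The generalized adjacency matrix is $\mathbf{A}=\alpha I+\beta D+\gamma A$. If all vertex degrees are positive or all are negative, the generalized normalized adjacency matrix is $\mathcal{A}=\alpha I+\gamma D^{-1/2}AD^{-1/2}$, where $D^{-1/2}$ is diagonal with $(D^{-1/2})_{u,u}=1/\sqrt{\deg(u)}$ if $\deg(u)>0$ and $-i/\sqrt{|\deg(u)|}$ if $\deg(u)<0$. $M$ denotes $\mathbf{A}$ or, when it is defined, $\mathcal{A}$; both are real symmetric. Let $M=\sum_j\lambda_jE_j$ be the spectral decomposition ($\lambda_j$ distinct eigenvalues, $E_j$ orthogonal projections onto the eigenspaces). Vertices $u,v$ are cospectral with respect to $M$ if $(E_j)_{u,u}=(E_j)_{v,v}$ for each $j$. Distinct vertices $u,v$ are twins if they have the same neighbours outside $\{u,v\}$, $(A)_{u,w}=(A)_{v,w}$ for every $w\neq u,v$, and $(A)_{u,u}=(A)_{v,v}$. *)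

(* Defs.v *)
From mathcomp Require Import all_boot all_order all_algebra.
From mathcomp Require Import sesquilinear spectral.
From mathcomp Require Import complex reals.

Set Implicit Arguments.
Unset Strict Implicit.
Unset Printing Implicit Defensive.

Import Order.TTheory GRing.Theory Num.Theory.
Local Open Scope ring_scope.
Local Open Scope complex_scope.

(* [edge x x] is a loop at [x]. The value of [weight] off the edges is
   meaningless: it is only ever used through [adjmx]. *)
Record wgraph (R : realType) (n : nat) := WGraph {
  edge : rel 'I_n;
  weight : 'I_n -> 'I_n -> R;
  edge_sym : symmetric edge;
  weight_sym : forall x y, edge x y -> weight x y = weight y x;
  weight_neq0 : forall x y, edge x y -> weight x y != 0;
  edge_connected : forall x y, connect edge x y
}.

Section Matrices.
Variables (R : realType) (n : nat) (X : wgraph R n).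

Definition adjmx : 'M[R]_n :=
  \matrix_(j, l) (if edge X j l then weight X j l else 0).

Definition deg (u : 'I_n) : R :=
  2%:R * adjmx u u + \sum_(j | j != u) adjmx u j.

Definition degmx : 'M[R]_n := diag_mx (\row_u deg u).

Definition gen_adjmx (alpha beta gamma : R) : 'M[R]_n :=
  alpha%:M + beta *: degmx + gamma *: adjmx.

Definition degrees_same_sign : Prop :=
  (forall u, 0 < deg u) \/ (forall u, deg u < 0).

(* Only meaningful under [degrees_same_sign]. The entries are purely
   imaginary when the degrees are negative, hence the complex matrix. *)
Definition degmx_invsqrt : 'M[R[i]]_n :=
  diag_mx (\row_u if 0 < deg u then ((Num.sqrt (deg u))^-1)%:C
                  else 0 -i* (Num.sqrt `|deg u|)^-1).

Definition gen_norm_adjmx (alpha gamma : R) : 'M[R[i]]_n :=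
  (alpha%:C)%:M
  + gamma%:C *: (degmx_invsqrt *m map_mx (real_complex R) adjmx *m degmx_invsqrt).

Definition twins (u v : 'I_n) : Prop :=
  [/\ u != v,
      forall w, w != u -> w != v -> edge X u w = edge X v w,
      forall w, w != u -> w != v -> adjmx u w = adjmx v w
    & adjmx u u = adjmx v v].

End Matrices.

(* The matrix of the orthogonal projection onto the [a]-eigenspace of [M].
   [eigenspace] and [proj_ortho] act on row vectors; for a real symmetric [M]
   the row and column eigenspaces agree up to transposition, the projections
   are real symmetric, and so this is the usual spectral idempotent. *)
Definition eigenproj (R : realType) (n : nat) (M : 'M[R[i]]_n) (a : R[i]) :
  'M[R[i]]_n := proj_ortho (eigenspace M a).

(* All eigenvalues of a real symmetric [M] are real, so letting [a] range over
   the complex eigenvalues adds none. *)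
Definition cospectral (R : realType) (n : nat) (M : 'M[R[i]]_n)
    (u v : 'I_n) : Prop :=
  forall a : R[i], eigenvalue M a -> eigenproj M a u u = eigenproj M a v v.

(* Main.v *)
Require Import Defs.
From mathcomp Require Import all_boot all_order all_algebra all_fingroup.
From mathcomp Require Import sesquilinear spectral.
From mathcomp Require Import complex reals.

Import Order.TTheory GRing.Theory Num.Theory.
Local Open Scope ring_scope.
Local Open Scope complex_scope.

(** Exchanging two twins and fixing every other vertex is an automorphism of
    the weighted graph: it preserves the adjacency matrix, hence the degrees,
    hence both generalized matrices [M].  So the permutation matrix [P] of this
    transposition commutes with [M], and therefore maps every eigenspace of [M]
    into itself.  As [P] is unitary and its adjoint commutes with [M] as well,
    [P] also preserves the orthogonal complements of the eigenspaces, and so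
    commutes with the spectral projections ([proj_ortho_comm]).  Comparing
    entries in [P E = E P] gives [E (s i) (s i) = E i i] for any automorphism
    [s] ([cospectral_perm]); the theorem is the case of the transposition. *)

(** If [P] and its adjoint both preserve [U], then [P] preserves the orthogonal
    complement of [U] too; [U] and its complement are then both [P]-stable,
    which is to say that [P] commutes with the projection onto [U]. *)
Lemma proj_ortho_comm {C : numClosedFieldType} {m n : nat} (U : 'M[C]_(m, n))
    (P : 'M[C]_n) :
  (U *m P <= U)%MS -> (U *m P ^t*%sesqui <= U)%MS ->
  P *m proj_ortho U = proj_ortho U *m P.
Proof.
move=> UP UPt.
have EP : (proj_ortho U *m P <= U)%MS.
  by apply: submx_trans UP; rewrite submxMr // proj_orthoE.
have := proj_ortho_compl_sub U 1%:M; rewrite mul1mx => EU.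
(* The complementary part is killed because, for [W] orthogonal to [U], pairing
   [W P] with [U] amounts to pairing [W] with [U P^*], which lies in [U]. *)
have /proj_ortho_0 :
    ((1%:M - proj_ortho U) *m P <= orthomx Num.conj (hermitian1mx n) U)%MS.
  have /submxP[B UPtE] := UPt.
  apply/orthomx1P; rewrite -mulmxA.
  have -> : P *m U ^t*%sesqui = ((U *m P ^t*) ^t*)%sesqui.
    rewrite trmx_mul map_mxM /= map_trmx trmxK; congr (_ *m _).
    by apply/matrixP => i j; rewrite !mxE conjCK.
  rewrite UPtE trmx_mul map_mxM mulmxA.
  by move/orthomx1P: EU => ->; rewrite mul0mx.
rewrite !mulmxBl mul1mx => /eqP.
by rewrite subr_eq0 => /eqP ->; rewrite proj_ortho_id.
Qed.

Lemma perm_mx_comm {T : pzSemiRingType} {n : nat} (M : 'M[T]_n) (s : 'S_n) :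
  perm_mx s *m M = M *m perm_mx s <-> forall i j, M (s i) (s j) = M i j.
Proof.
have -> : M *m perm_mx s = col_perm s^-1 M by rewrite col_permE invgK.
rewrite -row_permE; split=> [/matrixP sM i j|sM].
  by have := sM i (s j); rewrite !mxE permK.
by apply/matrixP => i j; rewrite !mxE -[j in LHS](permKV s) sM.
Qed.

(** Both the permutation matrix of [s] and its adjoint, which is that of the
    inverse of [s], commute with [M] and so preserve its eigenspaces; hence the
    spectral projections of [M] are invariant under [s] as well. *)
Lemma cospectral_perm {R : realType} {n : nat} (M : 'M[R[i]]_n) (s : 'S_n) :
  (forall i j, M (s i) (s j) = M i j) ->
  forall u, cospectral M u (s u).
Proof.
move=> sM u a _.
have sVM i j : M ((s^-1)%g i) ((s^-1)%g j) = M i j.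
  by rewrite -sM !permKV.
suff sE i j : eigenproj M a (s i) (s j) = eigenproj M a i j by rewrite sE.
move: i j; apply/perm_mx_comm/proj_ortho_comm.
  by apply: comm_mx_stable_eigenspace; apply/esym/perm_mx_comm.
rewrite tr_perm_mx map_perm_mx.
by apply: comm_mx_stable_eigenspace; apply/esym/perm_mx_comm.
Qed.

Section Automorphisms.
Variables (R : realType) (n : nat) (X : wgraph R n) (s : 'S_n).
Hypothesis sA : forall i j, adjmx X (s i) (s j) = adjmx X i j.

Lemma deg_perm u : deg X (s u) = deg X u.
Proof.
rewrite /deg sA; congr (_ + _).
rewrite (reindex_inj (@perm_inj _ s)) /=.
by apply: eq_big => [j|j _]; rewrite ?(inj_eq perm_inj) ?sA.
Qed.

Lemma gen_adjmx_perm alpha beta gamma i j :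
  gen_adjmx X alpha beta gamma (s i) (s j) = gen_adjmx X alpha beta gamma i j.
Proof.
have := sA i j; rewrite !mxE => ->.
by rewrite deg_perm !(inj_eq perm_inj).
Qed.

Lemma gen_norm_adjmx_perm alpha gamma i j :
  gen_norm_adjmx X alpha gamma (s i) (s j) = gen_norm_adjmx X alpha gamma i j.
Proof.
rewrite /gen_norm_adjmx /degmx_invsqrt mul_diag_mx mul_mx_diag.
have := sA i j; rewrite !mxE => ->.
by rewrite !deg_perm !(inj_eq perm_inj).
Qed.

End Automorphisms.

Lemma adjmx_sym {R : realType} {n : nat} (X : wgraph R n) i j :
  adjmx X i j = adjmx X j i.
Proof.
rewrite !mxE edge_sym; case: ifP => // ji.
by rewrite weight_sym // edge_sym.
Qed.

(** Twins agree on the edges to other vertices and on their loops; the one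
    remaining entry, the edge between them, is kept by symmetry. *)
Lemma twins_adjmx_tperm {R : realType} {n : nat} (X : wgraph R n) u v :
  twins X u v ->
  forall i j, adjmx X (tperm u v i) (tperm u v j) = adjmx X i j.
Proof.
case=> _ _ Auv Auu i j.
have Avu w : w != u -> w != v -> adjmx X w u = adjmx X w v.
  by move=> wu wv; rewrite !(adjmx_sym X w) Auv.
case: (tpermP u v i) => [->|->|/eqP iu /eqP iv];
  case: (tpermP u v j) => [->|->|/eqP ju /eqP jv] //.
- exact: adjmx_sym.
- by rewrite Auv.
- exact: adjmx_sym.
- by rewrite Auv.
- by rewrite Avu.
- by rewrite Avu.
Qed.

Theorem corollary2p11 (R : realType) (n : nat) (X : wgraph R n)
    (alpha beta gamma : R) (u v : 'I_n) :
  gamma != 0 ->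
  twins X u v ->
  cospectral (map_mx (real_complex R) (gen_adjmx X alpha beta gamma)) u v /\
  (degrees_same_sign X -> cospectral (gen_norm_adjmx X alpha gamma) u v).
Proof.
move=> _ /twins_adjmx_tperm sA.
have cosp M := @cospectral_perm R n M (tperm u v) ^~ u; rewrite tpermL in cosp.
split=> [|_]; apply: cosp => i j; last exact: gen_norm_adjmx_perm.
by rewrite mxE gen_adjmx_perm // [RHS]mxE.
Qed.
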